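(* Let $n\ge1$ be an integer and $\delta>0$. For any $p\ge1$, if $m=2n+1$, then $$\Lambda_p=\max\big\{1,\ n^{\frac{p-2}{p}}-1\big\}.$$
   Context: Let $e_j$ be the $j$th standard coordinate vector of $\mathbb{R}^n$. For $j\in\{1,\dots,2n+1\}$ define $z^1=0$, $z^j=\delta e_{j-1}$ for $2\le j\le n+1$, and $z^j=-\delta e_{j-n-1}$ for $n+2\le j\le 2n+1$; for $m\in\{n+2,\dots,2n+1\}$ set $\mathcal{Z}_m=\{z^1,\dots,z^m\}$. For $i\in\{1,\dots,m\}$, the $i$th minimum Frobenius norm Lagrange polynomial $L_i$ associated with $\mathcal{Z}_m$ is the unique polynomial $Q$ of degree at most two on $\mathbb{R}^n$ that minimizes the Frobenius norm $\|\nabla^2Q\|_{\mathsf F}$ subject to $Q(z^i)=1$ and $Q(z^j)=0$ for $j\in\{1,\dots,m\}\setminus\{i\}$. Let $\mathcal{B}_p(\delta)=\{x\in\mathbb{R}^n:\|x\|_p\le\delta\}$ (the smallest $\ell_p$-ball containing $\mathcal{Z}_m$), and define $$\Lambda_p=\max_{1\le i\le m}\ \max_{x\in\mathcal{B}_p(\delta)}|L_i(x)|.$$ *)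

(* Defs.v *)
From mathcomp Require Import all_boot all_order all_algebra.
From mathcomp Require Import boolp classical_sets reals exp.
From mathcomp Require Import mpoly.

Set Implicit Arguments.
Unset Strict Implicit.
Unset Printing Implicit Defensive.

Import Order.TTheory GRing.Theory Num.Theory.
Local Open Scope ring_scope.
Local Open Scope classical_set_scope.

Section Interpolation.
Context {R : realType}.

Definition is_max (S : set R) (v : R) : Prop := S v /\ ubound S v.

Section Dimension.
Context {n : nat}.
Implicit Types (Q : {mpoly R[n]}) (x : 'rV[R]_n).

Definition evalp Q x : R := Q.@[x ord0].

(* [msize] is one more than the total degree. *)
Definition degree_le2 Q : Prop := (msize Q <= 3)%N.

Definition hessian Q x : 'M[R]_n := \matrix_(k, l) (Q^`M(k)^`M(l)).@[x ord0].

Definition frobenius (A : 'M[R]_n) : R :=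
  Num.sqrt (\sum_k \sum_l A k l ^+ 2).

(* The Hessian of a polynomial of degree at most two is constant, so the point
   at which it is evaluated is immaterial. *)
Definition hessian_norm Q : R := frobenius (hessian Q 0).

Definition lp_norm (p : R) x : R := (\sum_k `|x ord0 k| `^ p) `^ p^-1.

Definition lp_ball (p delta : R) : set 'rV[R]_n :=
  [set x | lp_norm p x <= delta].

(* [k] counts coordinates from 0. *)
Definition coord_vec (k : nat) : 'rV[R]_n := \row_(l < n) ((l : nat) == k)%:R.

(* Indices are shifted by one: [point delta j] is z^(j+1). *)
Definition point (delta : R) (j : nat) : 'rV[R]_n :=
  if j == 0%N then 0
  else if (j <= n)%N then delta *: coord_vec (j - 1)
  else - (delta *: coord_vec (j - n - 1)).

Definition lagrange_feasible (delta : R) (m : nat) (i : 'I_m) Q : Prop :=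
  degree_le2 Q /\
  forall j : 'I_m, evalp Q (point delta j) = (j == i)%:R.

Definition is_mfn_lagrange (delta : R) (m : nat) (i : 'I_m) Q : Prop :=
  lagrange_feasible delta i Q /\
  forall Q', lagrange_feasible delta i Q' -> hessian_norm Q <= hessian_norm Q'.

(* [xget] selects the minimizer; the default value 0 is not feasible. *)
Definition mfn_lagrange (delta : R) (m : nat) (i : 'I_m) : {mpoly R[n]} :=
  xget 0 [set Q | is_mfn_lagrange delta i Q].

End Dimension.

(* [v] is the maximum over i of the maxima over x of |L_i(x)|; all these maxima
   are required to be attained. *)
Definition is_Lambda (n m : nat) (delta p v : R) : Prop :=
  exists2 M : 'I_m -> R,
    forall i : 'I_m,
      is_max [set `|evalp (@mfn_lagrange n delta m i) x| | x in lp_ball p delta]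
             (M i)
    & is_max (range M) v.

End Interpolation.

(* Main.v *)
Require Import Defs.
From mathcomp Require Import all_boot all_order all_algebra.
From mathcomp Require Import reals exp.
From mathcomp Require Import mpoly ring lra zify.
From mathcomp Require classical_sets.
Import Order.TTheory GRing.Theory Num.Theory.
Local Open Scope ring_scope.

(** A polynomial of degree at most two equals its second-order Taylor expansion
    at [0]. Its values at [0] and [± delta e_k] determine its value and gradient
    at [0] and the diagonal of its Hessian, and leave the off-diagonal entries
    free. Hence the Frobenius norm is smallest exactly when these vanish, and the
    Lagrange polynomials at [x = delta t] are [1 - \sum_k t_k ^ 2] and
    [(t_k ^ 2 ± t_k) / 2]. The latter are at most [1] in absolute value on the
    ball, with equality at [± e_k]. For the former, [\sum_k t_k ^ 2] is [0] at
    the center, and its maximum over the unit [p]-ball is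
    [max 1 (n ^ ((p - 2) / p))]. *)

(** * Monomials of degree at most two and their derivatives *)

Lemma mderivXU (R : realType) (n : nat) (k l : 'I_n) :
  ('X_k : {mpoly R[n]})^`M(l) = (k == l)%:R%:MP.
Proof.
rewrite mderivX mnm1E; case: eqP => [->|_]; last by rewrite scale0r mpolyC0.
by rewrite scale1r -{1}[U_(l)%MM]add0m addmK mpolyX0.
Qed.

(** The indices [k] and [l] may coincide; the two Kronecker products then add up to the factor 2 of
    a square. *)
Lemma meval_mderiv2XX (R : realType) (n : nat) (k l i j : 'I_n) (v : 'I_n -> R) :
  ('X_k * 'X_l : {mpoly R[n]})^`M(i)^`M(j).@[v] =
  (k == i)%:R * (l == j)%:R + (l == i)%:R * (k == j)%:R.
Proof.
rewrite mderivM mderivD !mderivM !mderivXU !mderivC !mul0r !mulr0 add0r addr0.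
by rewrite mevalD !mevalM !mevalC [(k == j)%:R * _]mulrC.
Qed.

(** A monomial of degree two is divisible by some variable, and the quotient has degree one. *)
Lemma monomial_le2 (n : nat) (mm : 'X_{1..n}) : (mdeg mm <= 2)%N ->
  [\/ mm = 0%MM, exists k, mm = U_(k)%MM | exists k l, mm = (U_(k) + U_(l))%MM].
Proof.
have deg1 (m' : 'X_{1..n}) : mdeg m' = 1%N -> exists k, m' = U_(k)%MM.
  by move/eqP/mdeg1P => [k /eqP]; exists k.
case E: (mdeg mm) => [|[|[|//]]] _.
- by apply: Or31; apply/eqP; rewrite -mdeg_eq0 E.
- by apply: Or32; exact: deg1.
- apply: Or33.
  have [k mk] : exists k, (0 < mm k)%N.
    case: (boolP [exists k, (0 < mm k)%N]) => [/existsP //|/existsPn z].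
    move: E; rewrite mdegE big1 // => k _; apply/eqP.
    by rewrite -leqn0 leqNgt; exact: z.
  have D : (mm - U_(k) + U_(k))%MM = mm.
    by apply: submK; apply/mnm_lepP => l; rewrite mnm1E; case: eqP => // <-.
  have [l El] : exists l, (mm - U_(k))%MM = U_(l)%MM.
    by apply: deg1; move: E; rewrite -{1}D mdegD mdeg1 addn1 => -[].
  by exists l, k; rewrite -El D.
Qed.

(** * Taylor expansion in degree two, and quadratics with diagonal Hessian *)

Section Taylor.
Context {R : realType} {n : nat}.
Implicit Types (Q : {mpoly R[n]}) (x : 'rV[R]_n).

(** Both sides are linear in [Q], so it suffices to check the monomials of its support, which have
    degree at most two. *)
Lemma taylor_degree_le2 Q x : degree_le2 Q ->
  evalp Q x = evalp Q 0 + \sum_k evalp Q^`M(k) 0 * x ord0 k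
    + 2^-1 * \sum_k \sum_l hessian Q 0 k l * (x ord0 k * x ord0 l).
Proof.
rewrite /degree_le2 /evalp => degQ.
under [X in 2^-1 * X]eq_bigr do under eq_bigr do rewrite mxE.
pose T P := P.@[x ord0] =
  P.@[(0 : 'rV[R]_n) ord0] + \sum_k P^`M(k).@[(0 : 'rV[R]_n) ord0] * x ord0 k +
  2^-1 * (\sum_k \sum_l (P^`M(k)^`M(l)).@[(0 : 'rV[R]_n) ord0]
     * (x ord0 k * x ord0 l)).
suff: T Q by [].
rewrite (mpolyE Q) big_seq; elim/big_ind: _ => [|P P' TP TP'|mm /msize_mdeg_lt].
- rewrite /T !meval0 !big1 ?mulr0 ?addr0 // => [k _|k _].
    by rewrite big1 // => l _; rewrite !mderiv0 meval0 mul0r.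
  by rewrite mderiv0 meval0 mul0r.
- rewrite /T !mevalD TP TP'.
  under [in RHS]eq_bigr do rewrite mderivD mevalD mulrDl.
  rewrite big_split /=.
  under [X in _ = _ + 2^-1 * X]eq_bigr
    do (under eq_bigr do rewrite !mderivD mevalD mulrDl; rewrite big_split).
  by rewrite big_split /=; ring.
move=> /leq_trans/(_ degQ) dm.
suff TX : T 'X_[mm].
  rewrite /T !mevalZ TX.
  under [in RHS]eq_bigr do rewrite mderivZ mevalZ -mulrA.
  rewrite -mulr_sumr.
  under [X in _ = _ + 2^-1 * X]eq_bigr
    do (under eq_bigr do rewrite !mderivZ mevalZ -mulrA; rewrite -mulr_sumr).
  by rewrite -mulr_sumr !mulrDr [2^-1 * (_ * _)]mulrCA.
have sumU (F : 'I_n -> R) k : \sum_j (k == j)%:R * F j = F k.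
  rewrite (bigD1 k) //= eqxx mul1r big1 ?addr0 // => j.
  by rewrite eq_sym => /negbTE ->; rewrite mul0r.
rewrite /T; case: (monomial_le2 _ _ dm) => [->|[k ->]|[k [l ->]]].
- rewrite mpolyX0 !meval1 !big1 ?mulr0 ?addr0 // => [k _|k _].
    by rewrite big1 // => l _; rewrite -mpolyC1 !mderivC ?mderiv0 meval0 mul0r.
  by rewrite -mpolyC1 mderivC meval0 mul0r.
- rewrite !mevalXU mxE add0r.
  under eq_bigr do rewrite mderivXU mevalC.
  rewrite sumU [X in _ * X]big1 ?mulr0 ?addr0 // => j _.
  by rewrite big1 // => l _; rewrite mderivXU mderivC meval0 mul0r.
(* For a product of two variables the value and gradient at 0 vanish, and each Kronecker term of the
   Hessian yields the product once, which the factor 1/2 compensates. *)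
rewrite mpolyXD !mevalM !mevalXU !mxE mul0r add0r.
rewrite [X in _ = X + _]big1 => [|j _]; last first.
  by rewrite mderivM !mderivXU mevalD !mevalM !mevalXU !mxE !mulr0 !mul0r addr0 mul0r.
rewrite add0r.
under eq_bigr => j _.
  under eq_bigr => i _.
    rewrite meval_mderiv2XX mulrDl [X in X + _]mulrACA [X in _ + X]mulrACA.
    over.
  rewrite big_split /= -!mulr_sumr !sumU; over.
by rewrite big_split /= -!mulr_suml !sumU; field.
Qed.

(** Halving [h k] makes [h] the diagonal of the Hessian. *)
Definition diag_quad (c : R) (g h : 'I_n -> R) : {mpoly R[n]} :=
  c%:MP + \sum_k (g k *: 'X_k + (h k / 2) *: ('X_k * 'X_k)).

Lemma diag_quad_degree c g h : degree_le2 (diag_quad c g h).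
Proof.
rewrite /degree_le2 /diag_quad.
apply: leq_trans (mmeasureD_le _ _ _) _.
rewrite geq_max msizeC; apply/andP; split; first by case: (_ != _).
apply: leq_trans (mmeasure_sum _ _ _ _) _.
apply/bigmax_leqP => k _.
apply: leq_trans (mmeasureD_le _ _ _) _; rewrite geq_max; apply/andP; split.
  by apply: leq_trans (msizeZ_le _ _) _; rewrite msizeX mdeg1.
by apply: leq_trans (msizeZ_le _ _) _; rewrite -mpolyXD msizeX mdegD !mdeg1.
Qed.

Lemma diag_quad_eval c g h x : evalp (diag_quad c g h) x =
  c + \sum_k (g k * x ord0 k + h k / 2 * x ord0 k ^+ 2).
Proof.
rewrite /evalp mevalD mevalC raddf_sum; congr (_ + _).
by apply: eq_bigr => k _; rewrite /= mevalD !mevalZ mevalM mevalXU.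
Qed.

Lemma diag_quad_hessian c g h x k l :
  hessian (diag_quad c g h) x k l = h k *+ (k == l).
Proof.
rewrite mxE mderivD mderivC add0r.
rewrite (raddf_sum (mderiv k)) (raddf_sum (mderiv l)) (raddf_sum (meval _)) /=.
under eq_bigr => j _.
  rewrite !mderivD !mderivZ mderivXU mderivC scaler0 add0r mevalZ meval_mderiv2XX.
  over.
rewrite (bigD1 k) //= big1 ?addr0 => [|j /negbTE jk].
  by rewrite eqxx; case: eqP => _ /=; field.
by rewrite jk !mul0r addr0 mulr0.
Qed.

End Taylor.

(** * The minimum Frobenius norm Lagrange polynomials *)

Section Minimizer.
Context {R : realType} {n : nat}.
Implicit Types (Q : {mpoly R[n]}) (x : 'rV[R]_n) (A B : 'M[R]_n).

Lemma frobenius_le A B : (frobenius A <= frobenius B) =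
  (\sum_k \sum_l A k l ^+ 2 <= \sum_k \sum_l B k l ^+ 2).
Proof.
by rewrite /frobenius ler_sqrt // sumr_ge0 // => k _; rewrite sumr_ge0 // => l _;
  exact: sqr_ge0.
Qed.

Lemma sum_sqr_diag A : \sum_k \sum_l A k l ^+ 2 =
  \sum_k A k k ^+ 2 + \sum_k \sum_(l | l != k) A k l ^+ 2.
Proof. by rewrite -big_split; apply: eq_bigr => k _; rewrite (bigD1 k). Qed.

Lemma frobenius_diag_le A B : (forall k, A k k = B k k) ->
  (forall k l, k != l -> B k l = 0) -> frobenius B <= frobenius A.
Proof.
move=> AB B0; rewrite frobenius_le !sum_sqr_diag.
under eq_bigr do rewrite -AB.
rewrite lerD2l [leLHS]big1 => [|k _].
  by apply: sumr_ge0 => k _; apply: sumr_ge0 => l _; exact: sqr_ge0.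
by rewrite big1 // => l lk; rewrite B0 ?expr0n // eq_sym.
Qed.

(** Uniqueness half of the minimization: the diagonals cancel, leaving a sum of off-diagonal squares
    of [A] that is at most 0. *)
Lemma frobenius_diag_eq0 A B : (forall k, A k k = B k k) ->
  (forall k l, k != l -> B k l = 0) -> frobenius A <= frobenius B ->
  forall k l, k != l -> A k l = 0.
Proof.
move=> AB B0; rewrite frobenius_le !sum_sqr_diag.
under [X in _ <= X + _]eq_bigr do rewrite -AB.
rewrite lerD2l [leRHS]big1 => [le0 k l kl|k _]; last first.
  by rewrite big1 // => l lk; rewrite B0 ?expr0n // eq_sym.
have row_ge0 (j : 'I_n) : true -> 0 <= \sum_(l | l != j) A j l ^+ 2.
  by move=> _; apply: sumr_ge0 => ? _; exact: sqr_ge0.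
have sum0 : \sum_k \sum_(l | l != k) A k l ^+ 2 = 0.
  by apply: le_anti; rewrite le0 sumr_ge0.
have row0 := psumr_eq0P row_ge0 sum0 (i:=k) isT.
apply/eqP; rewrite -sqrf_eq0; apply/eqP.
by apply: (psumr_eq0P _ row0); rewrite 1?eq_sym // => ? _; exact: sqr_ge0.
Qed.

Lemma point_pos (delta : R) (k : 'I_n) :
  point delta k.+1 = delta *: coord_vec k :> 'rV[R]_n.
Proof. by rewrite /point /= ltn_ord subn1. Qed.

Lemma point_neg (delta : R) (k : 'I_n) :
  point delta (n + k).+1 = - delta *: coord_vec k :> 'rV[R]_n.
Proof.
rewrite /point /= ifF; last by lia.
by rewrite scaleNr (_ : (n + k).+1 - n - 1 = k)%N //; lia.
Qed.

(** With 2n+1 points, every axis carries the center and both of [± delta e_k], which is why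
    interpolation fixes the gradient and the Hessian diagonal. *)
Lemma index_cases {j : nat} : (j < 2 * n + 1)%N ->
  [\/ j = 0%N, exists k : 'I_n, j = k.+1 | exists k : 'I_n, j = (n + k).+1].
Proof.
case: j => [|j] ltj; first exact: Or31.
have [jn|nj] := ltnP j n; first by apply: Or32; exists (Ordinal jn).
have jn : (j - n < n)%N by lia.
by apply: Or33; exists (Ordinal jn) => /=; lia.
Qed.

Lemma axisE (t : R) (k l : 'I_n) :
  (t *: coord_vec k) ord0 l = t * (l == k)%:R :> R.
Proof. by rewrite !mxE. Qed.

Lemma diag_quad_eval_axis c g h (t : R) (k : 'I_n) :
  evalp (diag_quad c g h) (t *: coord_vec k) = c + g k * t + h k / 2 * t ^+ 2.
Proof.
rewrite diag_quad_eval (bigD1 k) //= big1 => [|l /negbTE lk]; rewrite !axisE.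
  by rewrite eqxx !mulr1 addr0 addrA.
by rewrite lk /=; ring.
Qed.

Lemma taylor_axis Q (t : R) (k : 'I_n) : degree_le2 Q ->
  evalp Q (t *: coord_vec k) =
  evalp Q 0 + evalp Q^`M(k) 0 * t + hessian Q 0 k k / 2 * t ^+ 2.
Proof.
move=> degQ; rewrite taylor_degree_le2 //; congr (_ + _ + _).
  rewrite (bigD1 k) //= big1 => [|l /negbTE lk]; rewrite axisE.
    by rewrite eqxx mulr1 addr0.
  by rewrite lk !mulr0.
rewrite (bigD1 k) //= [X in _ + X]big1 => [|j /negbTE jk]; last first.
  by apply: big1 => l _; rewrite axisE jk mulr0 mul0r mulr0.
rewrite (bigD1 k) //= big1 => [|l /negbTE lk]; rewrite !axisE eqxx /=; first by field.
by rewrite lk !mulr0.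
Qed.

Context (delta : R) (i : 'I_(2 * n + 1)) (delta_gt0 : 0 < delta).

(** Central difference at 0 along axis [k] of the data equal to 1 at the point of index [i] and 0 at
    the others. *)
Definition lag_grad (k : 'I_n) : R :=
  ((i == k.+1 :> nat)%:R - (i == (n + k).+1 :> nat)%:R) / (2 * delta).

(** Second central difference of the same data. *)
Definition lag_curv (k : 'I_n) : R :=
  ((i == k.+1 :> nat)%:R + (i == (n + k).+1 :> nat)%:R
    - 2 * (i == 0 :> nat)%:R) / delta ^+ 2.

Definition lag_poly : {mpoly R[n]} :=
  diag_quad (i == 0 :> nat)%:R lag_grad lag_curv.

Lemma lag_poly_feasible : lagrange_feasible delta i lag_poly.
Proof.
have d0 : delta != 0 by rewrite gt_eqF.
split=> [|j]; first exact: diag_quad_degree.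
rewrite -val_eqE /= eq_sym.
case: (index_cases (ltn_ord j)) => [->|[k ->]|[k ->]].
- rewrite /point eqxx diag_quad_eval big1 ?addr0 // => k _.
  by rewrite mxE; ring.
- by rewrite point_pos diag_quad_eval_axis /lag_grad /lag_curv; field.
- by rewrite point_neg diag_quad_eval_axis /lag_grad /lag_curv; field.
Qed.

(** On each axis [Q] is a one-variable quadratic, recovered from its values at 0 and [± delta]. *)
Lemma feasible_coef Q : lagrange_feasible delta i Q ->
  [/\ evalp Q 0 = (i == 0 :> nat)%:R,
      forall k, evalp Q^`M(k) 0 = lag_grad k &
      forall k, hessian Q 0 k k = lag_curv k].
Proof.
have d0 : delta != 0 by rewrite gt_eqF.
move=> [degQ interp].
have val_at j : (j < 2 * n + 1)%N -> evalp Q (point delta j) = (i == j :> nat)%:R.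
  by move=> jm; have := interp (Ordinal jm); rewrite -val_eqE /= eq_sym.
have Q0 : evalp Q 0 = (i == 0 :> nat)%:R by rewrite -val_at // addn1.
have Qk (k : 'I_n) : evalp Q^`M(k) 0 = lag_grad k /\ hessian Q 0 k k = lag_curv k.
  have lk := ltn_ord k.
  have /val_at : (k.+1 < 2 * n + 1)%N by lia.
  have /val_at : ((n + k).+1 < 2 * n + 1)%N by lia.
  rewrite point_pos point_neg !taylor_axis // Q0 => En Ep.
  by rewrite /lag_grad /lag_curv -En -Ep; split; field.
by split=> // k; case: (Qk k).
Qed.

Lemma lag_poly_hessian k l : hessian lag_poly 0 k l = lag_curv k *+ (k == l).
Proof. exact: diag_quad_hessian. Qed.

Lemma lag_poly_minimal : is_mfn_lagrange delta i lag_poly.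
Proof.
split=> [|Q /feasible_coef[_ _ curvQ]]; first exact: lag_poly_feasible.
apply: frobenius_diag_le => k => [|l /negbTE kl]; rewrite lag_poly_hessian.
  by rewrite eqxx curvQ.
by rewrite kl.
Qed.

(** Since [mfn_lagrange] is a chosen minimizer, its values are known only once all minimizers are
    shown to agree. *)
Lemma minimal_eval Q x : is_mfn_lagrange delta i Q -> evalp Q x = evalp lag_poly x.
Proof.
move=> [feasQ minQ].
have [Q0 gradQ curvQ] := feasible_coef _ feasQ.
have offdiag0 : forall k l, k != l -> hessian Q 0 k l = 0.
  apply: (frobenius_diag_eq0 _ (hessian lag_poly 0)) (minQ _ lag_poly_feasible).
    by move=> k; rewrite lag_poly_hessian eqxx curvQ.
  by move=> k l /negbTE kl; rewrite lag_poly_hessian kl.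
rewrite diag_quad_eval taylor_degree_le2; last by case: feasQ.
rewrite -addrA Q0 mulr_sumr -big_split; congr (_ + _); apply: eq_bigr => k _ /=.
rewrite gradQ (bigD1 k) //= big1 => [|l lk]; last first.
  by rewrite offdiag0 ?mul0r // eq_sym.
by rewrite curvQ; field.
Qed.

Lemma mfn_lagrange_eval x : evalp (mfn_lagrange delta i) x =
  (i == 0 :> nat)%:R
    + \sum_k (lag_grad k * x ord0 k + lag_curv k / 2 * x ord0 k ^+ 2).
Proof.
(* The minimizer [lag_poly] shows that the set is nonempty, so [xget] returns one of its elements
   and not the default 0. *)
rewrite (minimal_eval _ x (classical_sets.xgetI 0 lag_poly_minimal)).
exact: diag_quad_eval.
Qed.

End Minimizer.

(** * Sums of powers of the coordinates on the unit p-ball *)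

Section Ball.
Context {R : realType} {n : nat}.
Implicit Types (x t : 'rV[R]_n).

(** Homogeneity pulls out [delta]; monotonicity of the powers [p] and [p^-1] on nonnegative reals
    then removes the outer root. *)
Lemma lp_ball_scale (delta p : R) t : 0 < delta -> 1 <= p ->
  lp_ball p delta (delta *: t) <-> \sum_k `|t ord0 k| `^ p <= 1.
Proof.
move=> d0 p1; have p0 : 0 < p by lra.
have p0' : p != 0 by rewrite gt_eqF.
have one_powR r : 1 `^ r = 1 :> R by rewrite powR1.
change (lp_norm p (delta *: t) <= delta <-> \sum_k `|t ord0 k| `^ p <= 1).
rewrite /lp_norm.
under [X in X `^ _]eq_bigr do rewrite mxE normrM powRM // gtr0_norm //.
rewrite -mulr_sumr powRM ?powR_ge0 ?sumr_ge0 // => [|? _]; last exact: powR_ge0.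
rewrite -powRrM mulfV // powRr1 ?(ltW d0) // ger_pMr //.
set s := \sum_k _; have s0 : 0 <= s by apply: sumr_ge0 => k _; exact: powR_ge0.
split=> s1.
  have <- : (s `^ p^-1) `^ p = s by rewrite -powRrM mulVf // powRr1.
  by rewrite -[leRHS](one_powR p) ge0_ler_powR // ?nnegrE ?powR_ge0 // ltW.
by rewrite -[leRHS](one_powR p^-1) ge0_ler_powR // ?nnegrE // invr_ge0 ltW.
Qed.

(** Young's inequality for [u * 1] with the conjugate exponents [q] and [q / (q - 1)], multiplied
    through by [q]. *)
Lemma bernoulli_powR (u q : R) : 0 <= u -> 1 < q -> q * (u - 1) <= u `^ q - 1.
Proof.
move=> u0 q1; have q0 : 0 < q by lra.
have := @conjugate_powR R u 1 q (q / (q - 1)) u0 ler01 q0.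
have qV : 0 < q / (q - 1) by rewrite divr_gt0 // subr_gt0.
have -> : q^-1 + (q / (q - 1))^-1 = 1 by field; rewrite !gt_eqF ?subr_gt0.
move=> /(_ qV erefl); rewrite mulr1 powR1 => le_u.
have {le_u} := ler_wpM2l (ltW q0) le_u.
have -> : q * (u `^ q / q + 1 / (q / (q - 1))) = u `^ q + (q - 1).
  by field; rewrite !gt_eqF ?subr_gt0.
by lra.
Qed.

Lemma coord_le1 (p : R) t : 1 <= p -> \sum_k `|t ord0 k| `^ p <= 1 ->
  forall k, `|t ord0 k| <= 1.
Proof.
move=> p1 sum1 k; rewrite leNgt; apply/negP => t1.
have : 1 < `|t ord0 k| `^ p.
  exact: lt_le_trans t1 (le1r_powR (ltW t1) p1).
apply/negP; rewrite -leNgt; apply: le_trans sum1.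
by rewrite (bigD1 k) //= lerDl sumr_ge0 // => *; exact: powR_ge0.
Qed.

(** The exponent [(p - 2) / p] changes sign at [p = 2]. Up to there, coordinates of modulus at most
    1 have squares below their p-th powers; beyond, a tangent-line inequality is used. *)
Lemma sum_sqr_le (p : R) t : (1 <= n)%N -> 1 <= p ->
  \sum_k `|t ord0 k| `^ p <= 1 ->
  \sum_k t ord0 k ^+ 2 <= Num.max 1 (n%:R `^ ((p - 2) / p)).
Proof.
move=> n1 p1 sum1; rewrite le_max; have p0 : 0 < p by lra.
have n0 : 0 < n%:R :> R by rewrite ltr0n.
have [p2|p2] := leP p 2; apply/orP; [left|right].
  apply: (le_trans _ sum1); apply: ler_sum => k _.
  have := coord_le1 _ _ p1 sum1 k => tk1.
  rewrite -real_normK ?num_real // -powR_mulrn //.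
  (* The monotonicity lemma [ger_powR] requires a positive base. *)
  have [->|tk0] := eqVneq (t ord0 k) 0.
    by rewrite normr0 !powR0 ?gt_eqF.
  by apply: ger_powR => //; rewrite normr_gt0 tk0.
(* The constant vector is extremal: apply Bernoulli's inequality to the ratios
   of [t_k ^ 2] to its common value [a]. *)
pose a : R := n%:R `^ (- (2 / p)).
have a0 : 0 < a by rewrite powR_gt0.
have aq : a `^ (p / 2) = n%:R^-1.
  rewrite -powRrM (_ : _ * _ = -1); last by field; rewrite gt_eqF.
  by rewrite powR_inv1 ?ltW.
have na : n%:R `^ ((p - 2) / p) = n%:R * a.
  rewrite (_ : (p - 2) / p = 1 + - (2 / p)); last by field; rewrite gt_eqF.
  by rewrite powRD ?(gt_eqF n0) ?implybT // (powRr1 (ltW n0)).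
(* For [u = t_k ^ 2 / a] and [q = p / 2], the q-th power of [u] is n times the p-th power of
   [|t_k|], by [aq]. *)
have term k : p / 2 * (t ord0 k ^+ 2 / a - 1) <= n%:R * `|t ord0 k| `^ p - 1.
  have u0 : 0 <= t ord0 k ^+ 2 / a by rewrite divr_ge0 ?sqr_ge0 ?ltW.
  have q1 : 1 < p / 2 by lra.
  apply: le_trans (bernoulli_powR _ _ u0 q1) _.
  have aV0 : 0 <= a^-1 by rewrite invr_ge0 ltW.
  rewrite powRM ?sqr_ge0 // -(powR_inv1 (ltW a0)) powRAC.
  rewrite aq powR_inv1 ?invr_ge0 ?(ltW n0) // invrK mulrC.
  rewrite -real_normK ?num_real // -powR_mulrn // -powRrM.
  by rewrite (_ : 2 * (p / 2) = p) //; field.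
have : \sum_k p / 2 * (t ord0 k ^+ 2 / a - 1) <= \sum_k (n%:R * `|t ord0 k| `^ p - 1).
  exact: ler_sum.
rewrite -mulr_sumr !sumrB -mulr_suml -mulr_sumr !sumr_const !card_ord => le_s.
(* The summed right-hand sides are at most [n - n = 0] by [sum1]. *)
have : p / 2 * ((\sum_k t ord0 k ^+ 2) / a - n%:R) <= 0.
  apply: le_trans le_s _; by rewrite subr_le0 -[leRHS]mulr1 ler_wpM2l // ltW.
by rewrite pmulr_rle0 ?divr_gt0 // subr_le0 ler_pdivrMr // na.
Qed.

(** Shows that the bound of [sum_sqr_le] is attained for [p >= 2]: each of the n coordinates has
    p-th power 1/n. *)
Lemma sum_sqr_const (p : R) : (1 <= n)%N -> 0 < p ->
  let t : 'rV[R]_n := const_mx (n%:R `^ - p^-1) in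
  \sum_k `|t ord0 k| `^ p = 1 /\
  \sum_k t ord0 k ^+ 2 = n%:R `^ ((p - 2) / p).
Proof.
move=> n1 p0 t; have n0 : 0 < n%:R :> R by rewrite ltr0n.
have pn0 : p != 0 by rewrite gt_eqF.
split.
  under eq_bigr do rewrite mxE ger0_norm ?powR_ge0 // -powRrM mulNr mulVf //.
  by rewrite sumr_const card_ord powR_inv1 ?(ltW n0) // -[LHS]mulr_natr mulVf ?gt_eqF.
under eq_bigr do rewrite mxE -powR_mulrn ?powR_ge0 // -powRrM.
rewrite sumr_const card_ord -[LHS]mulr_natl -{1}(powRr1 (ltW n0)) -powRD.
  by congr (_ `^ _); field.
by rewrite (gt_eqF n0) implybT.
Qed.

End Ball.

(** * Maxima of the Lagrange polynomials over the ball *)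

(** The sign [e] tells [delta e_k] from [- delta e_k]. The set is the unfolded form of an image. *)
Lemma is_max_axis (R : realType) (n : nat) (delta p e : R)
    (F : 'rV[R]_n -> R) (k : 'I_n) : 0 < delta -> 1 <= p -> `|e| = 1 ->
  (forall t, F (delta *: t) = (t ord0 k ^+ 2 + e * t ord0 k) / 2) ->
  is_max (fun y => exists2 x, lp_ball p delta x & `|F x| = y) 1.
Proof.
move=> d0 p1 e1 FE; have p0 : 0 < p by lra.
have ee : e * e = 1 by rewrite -expr2 -real_normK ?num_real // e1 expr1n.
split.
  exists (delta *: (e *: coord_vec k)).
    apply/lp_ball_scale => //; rewrite (bigD1 k) //= big1 => [|l /negbTE lk].
      by rewrite axisE eqxx mulr1 e1 powR1 addr0.
    by rewrite axisE lk mulr0 normr0 powR0 ?gt_eqF.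
  rewrite FE axisE eqxx mulr1 expr2 ee (_ : (1 + 1) / 2 = 1) ?normr1 //.
  by field.
move=> _ [x + <-].
have -> : x = delta *: (delta^-1 *: x) by rewrite scalerA mulfV ?scale1r ?gt_eqF.
move: (delta^-1 *: x) => t /(lp_ball_scale _ _ t d0 p1) sum1.
have tk := coord_le1 _ _ p1 sum1 k.
rewrite FE normrM [`|2^-1|]gtr0_norm ?invr_gt0 //.
have : `|t ord0 k ^+ 2 + e * t ord0 k| <= 1 + 1.
  apply: le_trans (ler_normD _ _) _; rewrite [`|e * _|]normrM e1 mul1r lerD // normrX.
  by rewrite expr_le1.
by lra.
Qed.

(** As [|1 - s|] is convex in the sum of squares [s], only the extreme values of [s] matter. *)
Lemma is_max_center (R : realType) (n : nat) (delta p : R)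
    (F : 'rV[R]_n -> R) : (1 <= n)%N -> 0 < delta -> 1 <= p ->
  (forall t, F (delta *: t) = 1 - \sum_k t ord0 k ^+ 2) ->
  is_max (fun y => exists2 x, lp_ball p delta x & `|F x| = y)
    (Num.max 1 (n%:R `^ ((p - 2) / p) - 1)).
Proof.
move=> n1 d0 p1 FE; have p0 : 0 < p by lra.
split.
  (* The center gives 1; the constant vector takes over once [n ^ ((p - 2) / p)] exceeds 2. *)
  case: (leP (n%:R `^ ((p - 2) / p) - 1) 1) => [_|N2].
    exists (delta *: 0).
      apply/lp_ball_scale => //; rewrite big1 // => k _.
      by rewrite mxE normr0 powR0 ?gt_eqF.
    by rewrite FE big1 ?subr0 ?normr1 // => k _; rewrite mxE expr0n.
  have [sum1 sumN] := sum_sqr_const p n1 p0.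
  exists (delta *: const_mx (n%:R `^ - p^-1)).
    by apply/lp_ball_scale => //; rewrite sum1.
  by rewrite FE sumN ler0_norm; lra.
move=> _ [x + <-].
have -> : x = delta *: (delta^-1 *: x) by rewrite scalerA mulfV ?scale1r ?gt_eqF.
move: (delta^-1 *: x) => t /(lp_ball_scale _ _ t d0 p1) sum1.
have := sum_sqr_le _ _ n1 p1 sum1; rewrite FE.
have : 0 <= \sum_k t ord0 k ^+ 2 by apply: sumr_ge0 => k _; exact: sqr_ge0.
rewrite !le_max ler_norml => s0 /orP[s1|sN].
  by apply/orP; left; lra.
case: (leP (1 - \sum_k t ord0 k ^+ 2) 0) => s1.
  by apply/orP; right; rewrite ler0_norm; lra.
by apply/orP; left; lra.
Qed.

Theorem proposition2p5p3 (R : realType) (n m : nat) (delta p : R)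
  (hn : (1 <= n)%N) (hdelta : 0 < delta) (hp : 1 <= p)
  (hm : m = (2 * n + 1)%N) :
  is_Lambda n m delta p (Num.max 1 (n%:R `^ ((p - 2) / p) - 1)).
Proof.
subst m; have d0 : delta != 0 by rewrite gt_eqF.
set v := Num.max _ _.
exists (fun i : 'I_(2 * n + 1) => if i == 0 :> nat then v else 1) => [i|].
  case: (index_cases (ltn_ord i)) => [iE|[k iE]|[k iE]]; rewrite iE /=.
  - apply: is_max_center => // t.
    (* At the center, [lag_grad] vanishes and [lag_curv] is [- 2 / delta ^ 2]. *)
    rewrite mfn_lagrange_eval // iE -sumrN; congr (_ + _).
    apply: eq_bigr => k _; rewrite /lag_grad /lag_curv iE !mxE /=.
    by field.
  - have same (l : 'I_n) : (k.+1 == l.+1 :> nat) = (l == k) by rewrite eqSS eq_sym.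
    have other (l : 'I_n) : (k.+1 == (n + l).+1 :> nat) = false by have := ltn_ord k; have := ltn_ord l; lia.
    apply: (is_max_axis _ _ _ _ 1 _ k) => // [|t]; first exact: normr1.
    rewrite mfn_lagrange_eval // iE add0r (bigD1 k) //= big1 => [|l /negbTE lk].
      by rewrite /lag_grad /lag_curv iE same other eqxx mxE /=; field.
    by rewrite /lag_grad /lag_curv iE same other lk /=; ring.
  - have same (l : 'I_n) : ((n + k).+1 == (n + l).+1 :> nat) = (l == k) by rewrite eqSS eqn_add2l eq_sym.
    have other (l : 'I_n) : ((n + k).+1 == l.+1 :> nat) = false by have := ltn_ord k; have := ltn_ord l; lia.
    (* The central difference is negative at this point, whence [e = -1]. *)
    apply: (is_max_axis _ _ _ _ (-1) _ k) => // [|t]; first exact: normrN1.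
    rewrite mfn_lagrange_eval // iE add0r (bigD1 k) //= big1 => [|l /negbTE lk].
      by rewrite /lag_grad /lag_curv iE same other eqxx mxE /=; field.
    by rewrite /lag_grad /lag_curv iE same other lk /=; ring.
have lt0 : (0 < 2 * n + 1)%N by rewrite addn1.
(* As [v >= 1], the largest of the maxima is the one at index 0. *)
split; first by exists (Ordinal lt0).
by move=> _ [i _ <-]; case: ifP => // _; rewrite le_max lexx.
Qed.
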